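(* Let $K\subset\mathbb{R}^2$ be an origin symmetric convex body with $o\in\mathrm{int}(K)$. Then $$\lambda_1(K)\,\lambda_1(K^* )\le\tfrac43.$$ Moreover, equality holds if and only if $K=\lambda U\cdot\mathrm{conv}\{\pm(2,1),\pm(1,2),\pm(-1,1)\}$ for some $\lambda>0$ and $U\in\mathrm{GL}_2(\mathbb{Z})$.
   Context: A convex body in $\mathbb{R}^d$ is a non-empty compact convex subset of $\mathbb{R}^d$; it is origin symmetric if $-K=K$; $o$ denotes the origin. For a convex body $C\subset\mathbb{R}^d$ with $o\in\mathrm{int}(C)$, the first successive minimum is $\lambda_1(C)=\min\{\lambda\ge 0:\lambda C\cap\mathbb{Z}^d\ne\{o\}\}$. $K^*=\{y\in\mathbb{R}^d:\langle x,y\rangle\le 1\ \forall x\in K\}$ is the polar set of $K$. *)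

(* Defs.v *)
From mathcomp Require Import all_boot all_order all_algebra.
From mathcomp Require Import all_classical all_reals all_analysis.
Import Order.TTheory GRing.Theory Num.Theory numFieldNormedType.Exports.
Set Implicit Arguments.
Unset Strict Implicit.
Unset Printing Implicit Defensive.
Local Open Scope classical_set_scope.
Local Open Scope ring_scope.

(* Points of R^d are row vectors.  The norm on 'rV[R]_d is the sup norm;
   compactness and interior depend only on its (usual) topology. *)

Definition convex_body (R : realType) (d : nat) (K : set 'rV[R]_d) : Prop :=
  [/\ K !=set0, compact K & convex_set K].

Definition origin_symmetric (R : realType) (d : nat) (K : set 'rV[R]_d) : Prop :=
  [set - x | x in K] = K.

Definition inner (R : realType) (d : nat) (x y : 'rV[R]_d) : R :=
  \sum_(i < d) x 0 i * y 0 i.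

Definition polar_set (R : realType) (d : nat) (K : set 'rV[R]_d) : set 'rV[R]_d :=
  [set y | forall x, K x -> inner x y <= 1].

Definition scale_set (R : realType) (d : nat) (l : R) (K : set 'rV[R]_d) :
  set 'rV[R]_d := [set l *: x | x in K].

Definition int_lattice {R : realType} {d : nat} : set 'rV[R]_d :=
  range (fun z : 'rV[int]_d => map_mx intr z).

(* The least element of A.  It exists when C is a convex body with the origin
   in its interior; xget falls back on 0 only when A has no least element. *)
Definition lambda1 (R : realType) (d : nat) (C : set 'rV[R]_d) : R :=
  let A := [set l : R | 0 <= l /\ scale_set l C `&` int_lattice <> [set 0]] in
  xget 0 (A `&` lbound A).

Definition conv_hull (R : realType) (d : nat) (A : set 'rV[R]_d) : set 'rV[R]_d :=
  \bigcap_(B in [set B : set 'rV[R]_d | convex_set B /\ A `<=` B]) B.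

(* The image of K under x |-> U x; with x a row vector, U x is x *m U^T.
   GL_d(Z) is the set of U : 'M[int]_d with U \in unitmx. *)
Definition int_mx_image (R : realType) (d : nat) (U : 'M[int]_d)
  (K : set 'rV[R]_d) : set 'rV[R]_d :=
  [set x *m (map_mx intr U)^T | x in K].

Definition vec2 (R : realType) (a b : R) : 'rV[R]_2 :=
  \row_(j < 2) [:: a; b]`_j.

Definition hexagon {R : realType} : set 'rV[R]_2 :=
  conv_hull [set` [:: vec2 2 1; - vec2 2 1; vec2 1 2; - vec2 1 2;
                      vec2 (-1) 1; - vec2 (-1) 1]].

(* Main.v *)
Require Import Defs.
From mathcomp Require Import all_boot all_order all_algebra.
From mathcomp Require Import all_classical all_reals all_analysis.
From mathcomp Require Import ring lra zify.
Import Order.TTheory GRing.Theory Num.Theory numFieldNormedType.Exports.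
Local Open Scope classical_set_scope.
Local Open Scope ring_scope.

(* Normalize lambda_1(K) = 1, so that K contains a primitive vector e1, which we
   extend to a lattice basis, and no nonzero lattice point is interior.  Suppose
   that every integer functional has maximum at least 4/3 on K.  A point of K at
   height t >= 4/3, together with +-e1, gives a chord of K at height 1 of length
   2(1 - 1/t) >= 1/2, and a shear moves its midpoint to abscissa in [0, 1).
   Separating (1,0), (0,1), (1,1) from the interior of K yields functionals
     f = x - s y,  g = y - r x,  l = q x + (1 - q) y
   bounded by 1 on K; the chord forces q, r in (0, 1], and then s in [0, 1].  The
   maxima of x, y and x - y are bounded by positive combinations of {f, l},
   {g, l} and {f, -g}; that these bounds are at least 4/3 reads
     1/s + 1/(1-q) <= 4,  1/q + 1/r <= 4,  1/(1-r) + 1/(1-s) <= 4.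
   As 1/x + 1/(1-x) >= 4 this forces q = r = s = 1/2, and then the three maxima
   equal 4/3 and are attained at the vertices of the hexagon |f|, |g|, |l| <= 1. *)

(** * Separating lines in the plane *)

Definition convex2 {R : realType} (Q : R -> R -> Prop) : Prop :=
  forall t a b c d, 0 <= t -> t <= 1 -> Q a b -> Q c d ->
    Q (t * a + (1 - t) * c) (t * b + (1 - t) * d).

(** The line sought passes through (1, 0). Points with b < 0 bound its coefficient c below by (a -
    1) / -b, points with b > 0 bound it above by (1 - a) / b. A segment from an upper to a lower
    point crosses the axis at abscissa at most 1, so every lower bound is at most every upper bound
    ([cross]), and c is the supremum of the lower bounds. *)
Lemma separation2 {R : realType} (Q : R -> R -> Prop) :
  convex2 Q -> (exists a b, Q a b /\ 0 < b) -> (exists a b, Q a b /\ b < 0) ->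
  (forall t, Q t 0 -> t <= 1) ->
  exists c, forall a b, Q a b -> a + c * b <= 1.
Proof.
move=> cvxQ [ap [bp [Qp bp0]]] [am [bm [Qm bm0]]] Q1.
have cross a b a' b' : Q a b -> 0 < b -> Q a' b' -> b' < 0 ->
    (a' - 1) / - b' <= (1 - a) / b.
  move=> Qab b0 Qab' b'0; have bb0 : 0 < b - b' by lra.
  have tE : 1 - - b' / (b - b') = b / (b - b') by field; lra.
  have t0 : 0 <= - b' / (b - b') by apply: divr_ge0; lra.
  have t1 : - b' / (b - b') <= 1 by rewrite ler_pdivrMr //; lra.
  have := cvxQ _ _ _ _ _ t0 t1 Qab Qab'; rewrite tE.
  have -> : - b' / (b - b') * b + b / (b - b') * b' = 0 by field; lra.
  move=> /Q1.
  have -> : - b' / (b - b') * a + b / (b - b') * a' =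
    (- b' * a + b * a') / (b - b') by field; lra.
  rewrite ler_pdivrMr // mul1r => le1.
  rewrite ler_pdivrMr; last lra.
  rewrite mulrAC ler_pdivlMr //; lra.
pose S := [set x : R | exists a b, [/\ Q a b, b < 0 & x = (a - 1) / - b]].
have ubS x : S x -> x <= (1 - ap) / bp.
  by move=> [a [b [Qab b0 ->]]]; exact: cross.
have S0 : S !=set0 by exists ((am - 1) / - bm), am, bm.
exists (sup S) => a b Qab.
have [b0|b0|b0] := ltgtP b 0.
- have : (a - 1) / - b <= sup S.
    by apply: ub_le_sup; [exists ((1 - ap) / bp) | exists a, b].
  rewrite ler_pdivrMr; [lra|lra].
- have : sup S <= (1 - a) / b.
    by apply: ge_sup => // x [a' [b' [Qab' b'0 ->]]]; exact: cross.
  rewrite ler_pdivlMr //; lra.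
- by rewrite b0 in Qab *; have := Q1 _ Qab; lra.
Qed.

(** * The extremal problem in lattice coordinates *)

(** The hexagon of the theorem scaled by k / 3: k = 3 gives the hull itself, and k = 2 gives |f|,
    |g|, |l| <= 1 with q = r = s = 1/2. *)
Definition hex_ineq {R : realType} (k a b : R) : Prop :=
  [/\ `|a + b| <= k, `|2 * b - a| <= k & `|2 * a - b| <= k].

(* Summing [u^-1 + v^-1 <= 4] over the three hypotheses gives at most 12, while
   [x^-1 + (1 - x)^-1 >= 4] for each of the three parameters. *)
Lemma half_of_sum_le {R : realType} (q r s : R) :
  0 < q < 1 -> 0 < r < 1 -> 0 < s < 1 ->
  q + r <= 4 * q * r -> (1 - q) + s <= 4 * (1 - q) * s ->
  (1 - r) + (1 - s) <= 4 * (1 - r) * (1 - s) ->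
  [/\ q = 1 / 2, r = 1 / 2 & s = 1 / 2].
Proof.
move=> q01 r01 s01 H1 H2 H3.
have inv_le (u v : R) : 0 < u -> 0 < v -> u + v <= 4 * u * v ->
    u^-1 + v^-1 <= 4.
  move=> u0 v0 uv; have -> : u^-1 + v^-1 = (u + v) / (u * v) by field; lra.
  by rewrite ler_pdivrMr ?mulr_gt0 //; lra.
have inv_ge (x : R) : 0 < x < 1 ->
    x^-1 + (1 - x)^-1 = 4 + (2 * x - 1) ^+ 2 / (x * (1 - x)).
  by move=> x01; field; lra.
have dev_ge0 (x : R) : 0 < x < 1 -> 0 <= (2 * x - 1) ^+ 2 / (x * (1 - x)).
  by move=> x01; rewrite divr_ge0 ?sqr_ge0 // mulr_ge0; lra.
have dev0 (x : R) : 0 < x < 1 -> (2 * x - 1) ^+ 2 / (x * (1 - x)) <= 0 ->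
    x = 1 / 2.
  move=> x01; rewrite ler_pdivrMr; last by rewrite mulr_gt0; lra.
  rewrite mul0r => le0; have : (2 * x - 1) ^+ 2 == 0.
    by rewrite eq_le le0 sqr_ge0.
  by rewrite sqrf_eq0 => /eqP; lra.
have {}H1 := inv_le q r ltac:(lra) ltac:(lra) H1.
have {}H2 := inv_le (1 - q) s ltac:(lra) ltac:(lra) H2.
have {}H3 := inv_le (1 - r) (1 - s) ltac:(lra) ltac:(lra) H3.
have := inv_ge q q01; have := inv_ge r r01; have := inv_ge s s01.
have := dev_ge0 q q01; have := dev_ge0 r r01; have := dev_ge0 s s01.
by move=> *; split; apply: dev0 => //; lra.
Qed.

(** Here [theta] is the abscissa at height 1 of the line from the origin to the high point, hence
    the midpoint of the chord at height 1. *)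
Lemma planar_normalized {R : realType} (Q : R -> R -> Prop) (theta t : R) :
  convex2 Q -> (forall a b, Q a b -> Q (- a) (- b)) -> Q 1 0 ->
  (forall (m n : int) (c : R), (m, n) != (0, 0) ->
     Q (c * m%:~R) (c * n%:~R) -> c <= 1) ->
  (forall m n : int, (m, n) != (0, 0) ->
     exists a b, Q a b /\ 4 / 3 <= m%:~R * a + n%:~R * b) ->
  0 <= theta -> theta < 1 -> 4 / 3 <= t -> Q (theta * t) t ->
  [/\ forall a b, Q a b -> hex_ineq 2 a b,
      Q (4 / 3) (2 / 3), Q (2 / 3) (4 / 3) & Q (2 / 3) (- (2 / 3))].
Proof.
move=> cvxQ symQ Q10 lat width th0 th1 t43 Qp.
(* Mixing the high point, with weight 1/t, and (-1, 0) or (1, 0) gives the ends of the chord, with c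
   = 1 - 1/t. *)
have [c [c14 Qch1 Qch2]] :
    exists c, [/\ 1 / 4 <= c, Q (theta - c) 1 & Q (theta + c) 1].
  have t0 : 0 <= t^-1 by rewrite invr_ge0; lra.
  have t1 : t^-1 <= 3 / 4.
    by rewrite -[3/4]invrK lef_pV2 ?posrE ?invf_div; lra.
  have tV : t^-1 * t = 1 by field; lra.
  have t1' : t^-1 <= 1 by lra.
  exists (1 - t^-1); split; first lra.
    have := cvxQ _ _ _ _ _ t0 t1' Qp (symQ _ _ Q10).
    by rewrite mulrCA tV !oppr0 mulr0 addr0 mulrN1 mulr1.
  have := cvxQ _ _ _ _ _ t0 t1' Qp Q10.
  by rewrite mulrCA tV !mulr0 addr0 !mulr1.
have [s f_le] : exists s, forall a b, Q a b -> a - s * b <= 1.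
  have [||x x0|d dP] := @separation2 _ Q cvxQ.
  - by exists (theta * t), t; split=> //; lra.
  - by exists (- (theta * t)), (- t); split; [exact: symQ | lra].
  - by apply: (lat 1 0) => //=; rewrite mulr1 mulr0.
  - by exists (- d) => a b /dP; lra.
have [r g_le] : exists r, forall a b, Q a b -> b - r * a <= 1.
  have [||||d dP] := @separation2 _ (fun a b => Q b a).
  - by move=> x a b a' b' x0 x1 Qab Qab'; exact: cvxQ.
  - by exists 0, 1; split.
  - by exists 0, (- 1); split; [rewrite -oppr0; exact: symQ | lra].
  - by move=> x Qx; apply: (lat 0 1) => //=; rewrite mulr1 mulr0.
  - by exists (- d) => a b /dP; lra.
(* In the coordinates x and y - x the lattice point (1, 1) becomes (1, 0). *)
have [q l_le] : exists q, forall a b, Q a b -> q * a + (1 - q) * b <= 1.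
  have [||||d dP] := @separation2 _ (fun a b => Q a (a + b)).
  - move=> x a b a' b' x0 x1 Qab Qab'; have := cvxQ _ _ _ _ _ x0 x1 Qab Qab'.
    by congr Q; ring.
  - exists (- 1), 1; split=> //; rewrite addNr -oppr0; exact: symQ.
  - by exists 1, (- 1); split; [rewrite subrr | lra].
  - by move=> x Qx; apply: (lat 1 1) => //=; rewrite mulr1 -[X in Q _ X]addr0.
  - exists (1 - d) => a b Qab.
    have /dP : Q a (a + (b - a)) by rewrite addrC subrK.
    lra.
have f_ge a b : Q a b -> -1 <= a - s * b by move=> /symQ /f_le; lra.
have g_ge a b : Q a b -> -1 <= b - r * a by move=> /symQ /g_le; lra.
have l_ge a b : Q a b -> -1 <= q * a + (1 - q) * b.
  by move=> /symQ /l_le; lra.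
have r1 : r <= 1 by have := g_ge _ _ Q10; lra.
have q1 : q <= 1 by have := l_le _ _ Q10; lra.
(* The signs follow from theta + c > 0 and theta - c < 1 at the two chord ends. *)
have r0 : 0 <= r by have := g_le _ _ Qch2; nra.
have q0 : 0 <= q by have := l_le _ _ Qch1; nra.
have [ax [bx [Qx wx]]] := width 1 0 isT.
have [ay [by_ [Qy wy]]] := width 0 1 isT.
have [az [bz [Qz wz]]] := width 1 (-1) isT.
rewrite /= ?mulrN1z mul1r ?mul0r ?addr0 ?add0r in wx wy wz.
(* If r = 0 or q = 0, then g or l is y, which would be at most 1 on the body. *)
have {}r0 : 0 < r.
  rewrite lt_def r0 andbT; apply/eqP => rE.
  by have := g_le _ _ Qy; rewrite rE; lra.
have {}q0 : 0 < q.
  rewrite lt_def q0 andbT; apply/eqP => qE.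
  by have := l_le _ _ Qy; rewrite qE; lra.
have thc : c <= theta by have := g_le _ _ Qch1; nra.
have thc' : theta + c <= 1 by have := l_le _ _ Qch2; nra.
(* r l + q g = (q + r - q r) y, evaluated where y >= 4/3. *)
have qr : q + r <= 4 * q * r.
  have := g_le _ _ Qy; have := l_le _ _ Qy => H1 H2.
  have {}H1 : r * (q * ay + (1 - q) * by_) <= r * 1 by rewrite ler_pM2l.
  have {}H2 : q * (by_ - r * ay) <= q * 1 by rewrite ler_pM2l.
  have : (q + r - q * r) * (4 / 3) <= (q + r - q * r) * by_.
    by apply: ler_wpM2l => //; nra.
  lra.
have r13 : 1 / 3 <= r by nra.
have q13 : 1 / 3 <= q by nra.
(* If s < 0, then f + s g = (1 - r s) x is at most 1 - s. With x >= 4/3 and r >= 1/3 this gives s <=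
   -3/5, whereas the chord inside 0 <= x <= 1 gives s >= -1/2. *)
have s0 : 0 <= s.
  rewrite leNgt; apply/negP => s_lt0.
  have s12 : - (1 / 2) <= s by have := f_le _ _ Qch2; lra.
  have := f_le _ _ Qx; have := g_ge _ _ Qx => H1 H2.
  have {}H1 : - s * -1 <= - s * (bx - r * ax) by rewrite ler_pM2l //; lra.
  have : (1 - r * s) * (4 / 3) <= (1 - r * s) * ax.
    by apply: ler_wpM2l => //; nra.
  nra.
(* Similarly, if s > 1, then f + (s - 1) l = (1 + (s - 1) q) (x - y) is at most s. This forces s >=
   8/5, against s <= 3/2 from the chord. *)
have s1 : s <= 1.
  rewrite leNgt; apply/negP => s_gt1.
  have s32 : s <= 3 / 2 by have := f_ge _ _ Qch1; lra.
  have := f_le _ _ Qz; have := l_le _ _ Qz => H1 H2.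
  have {}H1 : (s - 1) * (q * az + (1 - q) * bz) <= (s - 1) * 1.
    by rewrite ler_pM2l //; lra.
  have : (1 + (s - 1) * q) * (4 / 3) <= (1 + (s - 1) * q) * (az - bz).
    by apply: ler_wpM2l => //; nra.
  nra.
(* (1 - q) f + s l = (1 - q + s q) x. *)
have qs : (1 - q) + s <= 4 * (1 - q) * s.
  have := f_le _ _ Qx; have := l_le _ _ Qx => H1 H2.
  have {}H1 : s * (q * ax + (1 - q) * bx) <= s * 1 by rewrite ler_wpM2l.
  have {}H2 : (1 - q) * (ax - s * bx) <= (1 - q) * 1.
    by rewrite ler_wpM2l //; lra.
  have : (1 - q + s * q) * (4 / 3) <= (1 - q + s * q) * ax.
    by apply: ler_wpM2l => //; nra.
  lra.
(* (1 - r) f - (1 - s) g = (1 - r s) (x - y). *)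
have rs : (1 - r) + (1 - s) <= 4 * (1 - r) * (1 - s).
  have := f_le _ _ Qz; have := g_ge _ _ Qz => H1 H2.
  have {}H1 : (1 - s) * -1 <= (1 - s) * (bz - r * az).
    by rewrite ler_wpM2l //; lra.
  have {}H2 : (1 - r) * (az - s * bz) <= (1 - r) * 1.
    by rewrite ler_wpM2l //; lra.
  have : (1 - r * s) * (4 / 3) <= (1 - r * s) * (az - bz).
    by apply: ler_wpM2l => //; nra.
  lra.
have s0' : 0 < s.
  rewrite lt_def s0 andbT; apply/eqP => sE; rewrite {}sE in qs.
  have qE : q = 1 by lra.
  by have := l_le _ _ Qx; rewrite qE; lra.
have s1' : s < 1.
  rewrite lt_def s1 andbT; apply/eqP => sE; rewrite -{}sE in rs f_le.
  by have := f_le _ _ Qz; lra.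
have [qE rE sE] : [/\ q = 1 / 2, r = 1 / 2 & s = 1 / 2].
  apply: half_of_sum_le => //; apply/andP; split=> //.
  - by rewrite lt_def q1 andbT; apply/eqP => qE; rewrite -qE in qs; lra.
  - by rewrite lt_def r1 andbT; apply/eqP => rE; rewrite -rE in rs; lra.
rewrite {}qE {}rE {}sE in f_le g_le l_le f_ge g_ge l_ge.
split.
- move=> a b Qab.
  have := f_le _ _ Qab; have := g_le _ _ Qab; have := l_le _ _ Qab.
  have := f_ge _ _ Qab; have := g_ge _ _ Qab; have := l_ge _ _ Qab.
  by split; rewrite ler_norml; apply/andP; split; lra.
(* As f + l = 3x/2, the bound x >= 4/3 forces f = l = 1, which determines the point. The other two
   vertices arise likewise from g, l and from f, -g. *)
- have := f_le _ _ Qx; have := l_le _ _ Qx => H1 H2.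
  by have [<- <-] : ax = 4 / 3 /\ bx = 2 / 3 by split; lra.
- have := g_le _ _ Qy; have := l_le _ _ Qy => H1 H2.
  by have [<- <-] : ay = 2 / 3 /\ by_ = 4 / 3 by split; lra.
- have := f_le _ _ Qz; have := g_ge _ _ Qz => H1 H2.
  by have [<- <-] : az = 2 / 3 /\ bz = - (2 / 3) by split; lra.
Qed.

Lemma planar_extremal {R : realType} (Q : R -> R -> Prop) :
  convex2 Q -> (forall a b, Q a b -> Q (- a) (- b)) -> Q 1 0 ->
  (forall (m n : int) (c : R), (m, n) != (0, 0) ->
     Q (c * m%:~R) (c * n%:~R) -> c <= 1) ->
  (forall m n : int, (m, n) != (0, 0) ->
     exists a b, Q a b /\ 4 / 3 <= m%:~R * a + n%:~R * b) ->
  exists k : int, let P a b := Q (a + k%:~R * b) b in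
  [/\ forall a b, P a b -> hex_ineq 2 a b,
      P (4 / 3) (2 / 3), P (2 / 3) (4 / 3) & P (2 / 3) (- (2 / 3))].
Proof.
move=> cvxQ symQ Q10 lat width.
have [px [t [Qp]]] := width 0 1 isT; rewrite mul0r mul1r add0r => t43.
(* The shear by the integer part of px / t moves the ratio of abscissa to height into [0, 1). *)
pose k := Num.floor (px / t); exists k => P.
have := floor_itv (px / t); rewrite -/k => /andP[k1 k2].
rewrite intrD in k2.
apply: (@planar_normalized _ P (px / t - k%:~R) t) => //; try lra.
- move=> x a b a' b' x0 x1 Pab Pab'.
  by have := cvxQ _ _ _ _ _ x0 x1 Pab Pab'; congr Q; ring.
- by move=> a b /symQ; congr Q; ring.
- by rewrite /P mulr0 addr0.
- move=> m n c mn Pc; apply: (lat (m + k * n) n).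
    apply: contra mn; rewrite !xpair_eqE => /andP[+ /eqP n0].
    by rewrite n0 mulr0 addr0 eqxx andbT.
  by move: Pc; rewrite /P intrD intrM; congr Q; ring.
(* Functionals transform by the inverse shear: (m, n) in the new coordinates is (m, n - m k) in the
   old ones. *)
- move=> m n mn; have [|a [b [Qab w]]] := width m (n - m * k).
    apply: contra mn; rewrite !xpair_eqE => /andP[/eqP m0].
    by rewrite m0 mul0r subr0 eqxx.
  exists (a - k%:~R * b), b; split; first by rewrite /P subrK.
  by move: w; rewrite intrB intrM; lra.
- by move: Qp; rewrite /P; congr Q; field; lra.
Qed.

(** * Coordinates, inner products and convexity *)

Lemma vec2E0 {R : realType} (a b : R) : vec2 a b 0 0 = a.
Proof. by rewrite mxE. Qed.

Lemma vec2E1 {R : realType} (a b : R) : vec2 a b 0 1 = b.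
Proof. by rewrite mxE. Qed.

Lemma rV2P {R : Type} (x y : 'rV[R]_2) :
  x 0 0 = y 0 0 -> x 0 1 = y 0 1 -> x = y.
Proof.
move=> e0 e1; apply/rowP => j.
by case: (unliftP 0 j) => [i|] ->; rewrite ?(ord1 i) //; move: e1;
  congr (x 0 _ = y 0 _); exact/val_inj.
Qed.

Lemma vec2_eta {R : realType} (x : 'rV[R]_2) : x = vec2 (x 0 0) (x 0 1).
Proof. by apply: rV2P; rewrite ?vec2E0 ?vec2E1. Qed.

Lemma vec2D {R : realType} (a b c d : R) :
  vec2 a b + vec2 c d = vec2 (a + c) (b + d).
Proof. by apply: rV2P; rewrite mxE ?vec2E0 ?vec2E1. Qed.

Lemma vec2Z {R : realType} (k a b : R) : k *: vec2 a b = vec2 (k * a) (k * b).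
Proof. by apply: rV2P; rewrite mxE ?vec2E0 ?vec2E1. Qed.

Lemma vec2N {R : realType} (a b : R) : - vec2 a b = vec2 (- a) (- b).
Proof. by apply: rV2P; rewrite mxE ?vec2E0 ?vec2E1. Qed.

Lemma inner2E {R : realType} (x y : 'rV[R]_2) :
  inner x y = x 0 0 * y 0 0 + x 0 1 * y 0 1.
Proof.
by rewrite /inner big_ord_recl big_ord1; congr (_ + x 0 _ * y 0 _);
  exact/val_inj.
Qed.

Lemma innerE {R : realType} {d : nat} (x y : 'rV[R]_d) :
  inner x y = (x *m y^T) 0 0.
Proof. by rewrite mxE; apply: eq_bigr => i _; rewrite mxE. Qed.

Lemma inner_mulmx {R : realType} {d : nat} (x y : 'rV[R]_d) (A : 'M[R]_d) :
  inner (x *m A) y = inner x (y *m A^T).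
Proof. by rewrite !innerE trmx_mul trmxK mulmxA. Qed.

Lemma innerZl {R : realType} {d : nat} (k : R) (x y : 'rV[R]_d) :
  inner (k *: x) y = k * inner x y.
Proof. by rewrite !innerE -scalemxAl mxE. Qed.

Lemma innerZr {R : realType} {d : nat} (k : R) (x y : 'rV[R]_d) :
  inner x (k *: y) = k * inner x y.
Proof. by rewrite !innerE linearZ -scalemxAr mxE. Qed.

Lemma inner_continuous {R : realType} {d : nat} (y : 'rV[R]_d) :
  continuous (fun x => inner x y).
Proof.
have -> : (fun x => inner x y) = \sum_(i < d) (fun x => x 0 i * y 0 i).
  by apply/funext => x; rewrite fct_sumE.
elim/big_ind: _ => [|f g cf cg|i _].
- exact: cst_continuous.
- by move=> x; apply: continuousD; [exact: cf | exact: cg].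
- have ci : continuous (fun x : 'rV[R]_d => x 0 i) by exact: coord_continuous.
  by move=> x; apply: continuousM; [exact: ci | exact: cst_continuous].
Qed.

Lemma convex_setP {R : realType} {d : nat} (A : set 'rV[R]_d) :
  convex_set A <-> forall t x y, 0 <= t -> t <= 1 -> A x -> A y ->
    A (t *: x + (1 - t) *: y).
Proof.
split=> [cA t x y t0 t1 Ax Ay|cA x y t xA yA]; last first.
  by apply/mem_set; apply: cA => //; exact/set_mem.
have := cA x y (Itv01 t0 t1) (mem_set Ax) (mem_set Ay).
by move=> /set_mem.
Qed.

(** * Lattice points and the first minimum *)

Lemma intr_rV_eq0 {R : realType} {d : nat} (z : 'rV[int]_d) :
  (map_mx intr z == 0 :> 'rV[R]_d) = (z == 0).
Proof.
apply/eqP/eqP => [/rowP zE|->]; last by rewrite map_mx0.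
by apply/rowP => j; have := zE j; rewrite !mxE => /eqP; rewrite intr_eq0 => /eqP.
Qed.

Lemma scale_lattice_neqP {R : realType} {d : nat} (C : set 'rV[R]_d) (m : R) :
  C 0 -> scale_set m C `&` int_lattice <> [set 0] <->
    exists2 z : 'rV[int]_d, z != 0 & scale_set m C (map_mx intr z).
Proof.
move=> C0; split=> [|[z z0 mCz] E].
  apply: contra_notP => nz; apply/seteqP; split=> [x [mCz [z _ zE]]|x ->].
    rewrite /= -zE; apply/eqP; rewrite intr_rV_eq0; apply/negPn/negP => z0.
    by apply: nz; exists z => //; rewrite zE.
  split; first by exists 0; rewrite ?scaler0.
  by exists 0; rewrite ?map_mx0.
have : (scale_set m C `&` int_lattice) (map_mx intr z).
  by split=> //; exists z.
by rewrite E => /eqP; rewrite intr_rV_eq0; exact/negP.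
Qed.

(** The default of [xget] is 0, so a nonzero value is a genuine least element. A product of minima
    that is at least 4/3 therefore supplies both minima. *)
Lemma lambda1_neq0 {R : realType} {d : nat} (C : set 'rV[R]_d) :
  C 0 -> lambda1 C != 0 ->
  [/\ 0 < lambda1 C,
      exists2 z : 'rV[int]_d, z != 0 & scale_set (lambda1 C) C (map_mx intr z) &
      forall (m : R) (z : 'rV[int]_d), 0 <= m -> z != 0 ->
        scale_set m C (map_mx intr z) -> lambda1 C <= m].
Proof.
move=> C0; rewrite /lambda1.
case: xgetP => [l _ [[l0 /scale_lattice_neqP lA] lb]|]; last by rewrite eqxx.
move=> ln0; split=> [||m z m0 z0 mz]; first by rewrite lt_def ln0.
- exact: lA.
- by apply: lb; split=> //; apply/scale_lattice_neqP => //; exists z.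
Qed.

Lemma lambda1_eq {R : realType} {d : nat} (C : set 'rV[R]_d) (l : R)
    (z : 'rV[int]_d) :
  C 0 -> 0 <= l -> z != 0 -> scale_set l C (map_mx intr z) ->
  (forall (m : R) (w : 'rV[int]_d), 0 <= m -> w != 0 ->
     scale_set m C (map_mx intr w) -> l <= m) ->
  lambda1 C = l.
Proof.
move=> C0 l0 z0 lz lb; have lmin : [set m : R | 0 <= m /\
    scale_set m C `&` int_lattice <> [set 0]] l.
  by split=> //; apply/scale_lattice_neqP => //; exists z.
have llb : lbound [set m : R | 0 <= m /\
    scale_set m C `&` int_lattice <> [set 0]] l.
  by move=> m [m0 /scale_lattice_neqP[//|w w0 mw]]; exact: (lb _ w).
apply: xget_unique; first by split.
by move=> m [mA mlb]; apply/eqP; rewrite eq_le mlb //= llb.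
Qed.

(** * The hexagon by inequalities *)

(** The inequalities are convex and hold at the vertices. Conversely, the three forms vanish on the
    three diagonals, so their signs select one of six sectors spanned by adjacent vertices. There
    the point is a nonnegative combination whose coefficients sum to at most 1. *)
Lemma hexagonP {R : realType} (x : 'rV[R]_2) :
  hexagon x <-> hex_ineq 3 (x 0 0) (x 0 1).
Proof.
split=> [hx|].
  apply: (hx [set y | hex_ineq 3 (y 0 0) (y 0 1)]); split.
    apply/convex_setP => t y z t0 t1; rewrite /= !mxE.
    set y0 := y 0 0; set y1 := y 0 1; set z0 := z 0 0; set z1 := z 0 1.
    rewrite /hex_ineq !ler_norml => -[/andP[? ?] /andP[? ?] /andP[? ?]].
    move=> -[/andP[? ?] /andP[? ?] /andP[? ?]].
    by split; apply/andP; split; nra.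
  move=> y /=; rewrite !inE => /or4P[|||/or3P[]] /eqP ->;
    rewrite ?mxE /= /hex_ineq !ler_norml; split; apply/andP; split; lra.
move=> hx B [/convex_setP cB vB].
have V v : v \in [:: vec2 2 1; - vec2 2 1; vec2 1 2; - vec2 1 2;
    vec2 (-1) 1; - vec2 (-1) 1] -> B v by move=> vv; exact: vB.
have B0 : B 0.
  have -> : (0 : 'rV[R]_2) =
      (1 / 2) *: vec2 2 1 + (1 - 1 / 2) *: - vec2 2 1.
    by rewrite vec2N !vec2Z vec2D; apply: rV2P; rewrite !mxE /=; lra.
  by apply: cB; [lra|lra| |]; apply: V; rewrite !inE eqxx ?orbT.
(* The missing weight 1 - a - b goes to the origin. *)
have cone v w a b : B v -> B w -> 0 <= a -> 0 <= b -> a + b <= 1 ->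
    B (a *: v + b *: w).
  move=> Bv Bw a0 b0 ab1.
  have [ab0|abn0] := eqVneq (a + b) 0.
    have [-> ->] : a = 0 /\ b = 0 by split; lra.
    by rewrite !scale0r addr0.
  have abp : 0 < a + b by rewrite lt_def abn0 addr_ge0.
  have t0 : 0 <= a / (a + b) by rewrite divr_ge0 // ltW.
  have t1 : a / (a + b) <= 1 by rewrite ler_pdivrMr //; lra.
  have := cB _ _ _ (addr_ge0 a0 b0) ab1 (cB _ _ _ t0 t1 Bv Bw) B0.
  rewrite scaler0 addr0 scalerDr !scalerA.
  by congr (B (_ *: _ + _ *: _)); field.
have cone2 a b c d s t : B (vec2 a b) -> B (vec2 c d) ->
    0 <= s -> 0 <= t -> s + t <= 1 ->
    x 0 0 = s * a + t * c -> x 0 1 = s * b + t * d -> B x.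
  move=> Bv Bw s0 t0 st1 x0 x1; rewrite (vec2_eta x) x0 x1 -vec2D -!vec2Z.
  exact: cone.
move: hx; set a := x 0 0 in cone2 *; set b := x 0 1 in cone2 *.
rewrite /hex_ineq !ler_norml => -[/andP[h1 h2] /andP[h3 h4] /andP[h5 h6]].
have [p1|p1] := lerP 0 (a + b); have [p2|p2] := lerP 0 (2 * b - a);
  have [p3|p3] := lerP 0 (2 * a - b); try lra.
- apply: (cone2 2 1 1 2 ((2 * a - b) / 3) ((2 * b - a) / 3)); try lra;
  by apply: V; rewrite !inE ?vec2N ?opprK eqxx ?orbT.
- apply: (cone2 1 2 (-1) 1 ((a + b) / 3) ((b - 2 * a) / 3)); try lra;
  by apply: V; rewrite !inE ?vec2N ?opprK eqxx ?orbT.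
- apply: (cone2 2 1 (- - 1) (- 1) ((a + b) / 3) ((a - 2 * b) / 3)); try lra;
  by apply: V; rewrite !inE ?vec2N ?opprK eqxx ?orbT.
- apply: (cone2 (-2) (-1) (-1) 1 (- (a + b) / 3) ((2 * b - a) / 3)); try lra;
  by apply: V; rewrite !inE ?vec2N ?opprK eqxx ?orbT.
- apply: (cone2 (-1) (-2) (- - 1) (-1) (- (a + b) / 3) ((2 * a - b) / 3)); try lra;
  by apply: V; rewrite !inE ?vec2N ?opprK eqxx ?orbT.
- apply: (cone2 (-2) (-1) (-1) (-2) ((b - 2 * a) / 3) ((a - 2 * b) / 3)); try lra;
  by apply: V; rewrite !inE ?vec2N ?opprK eqxx ?orbT.
Qed.

(** * Integer changes of basis *)

Definition mx2 {T : Type} (a b c d : T) : 'M[T]_2 :=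
  \matrix_(i, j) if i == 0 then if j == 0 then a else b
                 else if j == 0 then c else d.

Lemma mulmx_mx2 {T : pzSemiRingType} (a b c d a' b' c' d' : T) :
  mx2 a b c d *m mx2 a' b' c' d' =
  mx2 (a * a' + b * c') (a * b' + b * d') (c * a' + d * c') (c * b' + d * d').
Proof.
apply/matrixP => i j; rewrite !mxE big_ord_recl big_ord1 !mxE /=.
by case: (i == 0); case: (j == 0).
Qed.

Lemma mx2_1 {T : pzSemiRingType} : mx2 1 0 0 1 = 1%:M :> 'M[T]_2.
Proof.
apply/matrixP => i j; rewrite !mxE.
by case: (unliftP 0 i) => [i'|] ->; case: (unliftP 0 j) => [j'|] ->;
  rewrite ?(ord1 i') ?(ord1 j').
Qed.

Lemma vec2_mulmx {R : realType} (x y : R) (a b c d : int) :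
  vec2 x y *m map_mx intr (mx2 a b c d) =
  vec2 (x * a%:~R + y * c%:~R) (x * b%:~R + y * d%:~R).
Proof.
by apply: rV2P; rewrite ?vec2E0 ?vec2E1 mxE big_ord_recl big_ord1 !mxE.
Qed.

Lemma intr_rV2E {R : realType} (z : 'rV[int]_2) :
  map_mx intr z = vec2 (z 0 0)%:~R (z 0 1)%:~R :> 'rV[R]_2.
Proof. by apply: rV2P; rewrite ?vec2E0 ?vec2E1 mxE. Qed.

Lemma intmx_inv {R : realType} {d : nat} (W : 'M[int]_d) : W \in unitmx ->
  map_mx intr W *m map_mx intr (invmx W) = 1%:M :> 'M[R]_d /\
  map_mx intr (invmx W) *m map_mx intr W = 1%:M :> 'M[R]_d.
Proof. by move=> Wu; rewrite -!map_mxM mulmxV // mulVmx // map_mx1. Qed.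

Lemma rV2_neq0 (z : 'rV[int]_2) : (z != 0) = ((z 0 0, z 0 1) != (0, 0)).
Proof.
congr (~~ _); rewrite xpair_eqE; apply/eqP/andP => [->|[/eqP z0 /eqP z1]].
  by rewrite !mxE.
by apply: rV2P; rewrite mxE.
Qed.

(** * The two minima of the hexagon *)

(** The three forms are integers of absolute value at most 1. The last two differ by 3 (a - b), so a
    = b, and then a + b = 2 a forces a = 0. *)
Lemma hex_ineq_int {R : realType} (c : R) (a b : int) :
  c < 2 -> hex_ineq c (a%:~R : R) b%:~R -> a = 0 /\ b = 0.
Proof.
move=> c2; have lt2 (m : int) : `|m%:~R| <= c -> - 2 < m < 2.
  move=> /le_lt_trans /(_ c2); rewrite ltr_norml => /andP[h1 h2].
  by apply/andP; split; rewrite -(ltr_int R) ?intrN.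
move=> [].
have -> : (a%:~R : R) + b%:~R = (a + b)%:~R by rewrite intrD.
have -> : 2 * (b%:~R : R) - a%:~R = (2 * b - a)%:~R by rewrite intrB intrM.
have -> : 2 * (a%:~R : R) - b%:~R = (2 * a - b)%:~R by rewrite intrB intrM.
by move=> /lt2 h1 /lt2 h2 /lt2 h3; split; lia.
Qed.

Lemma hex_ineqZ {R : realType} (c k a b : R) :
  0 <= c -> hex_ineq k a b -> hex_ineq (k * c) (c * a) (c * b).
Proof.
rewrite /hex_ineq !ler_norml => c0.
by move=> [/andP[? ?] /andP[? ?] /andP[? ?]]; split; apply/andP; split; nra.
Qed.

Lemma rV2_mulmx_neq0 {d : nat} (z : 'rV[int]_d) (W : 'M[int]_d) :
  W \in unitmx -> z != 0 -> z *m W != 0.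
Proof.
move=> Wu; apply: contra => /eqP zW0.
by rewrite -[z](mulmxK Wu) zW0 mul0mx.
Qed.

(** Undoing U reduces to the standard lattice: (3/2, 0) is on the boundary of the hexagon, so (1, 0)
    is reached at 2/3, and a smaller dilate satisfies [hex_ineq] with a constant below 2. *)
Lemma lambda1_hexagon {R : realType} (l : R) (U : 'M[int]_2) :
  0 < l -> U \in unitmx ->
  lambda1 (scale_set l (int_mx_image U hexagon)) = 2 / (3 * l).
Proof.
move=> l0 Uu; pose W := U^T; have Wu : W \in unitmx by rewrite unitmx_tr.
have UW : (map_mx intr U)^T = map_mx intr W :> 'M[R]_2 by rewrite map_trmx.
have [WV VW] := @intmx_inv R _ _ Wu.
pose e : 'rV[int]_2 := \row_j (if j == 0 then 1 else 0).
have e0 : e != 0 by rewrite rV2_neq0 !mxE.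
apply: (@lambda1_eq _ _ _ _ (e *m W)).
- exists 0; last by rewrite scaler0.
  exists 0; last by rewrite mul0mx.
  by apply/hexagonP; rewrite /hex_ineq !mxE !mulr0 subrr addr0 normr0; split; lra.
- by apply: divr_ge0; lra.
- exact: rV2_mulmx_neq0.
- exists (l *: (vec2 (3 / 2) 0 *m map_mx intr W)).
    exists (vec2 (3 / 2) 0 *m map_mx intr W) => //.
    exists (vec2 (3 / 2) 0); last by rewrite UW.
    apply/hexagonP; rewrite vec2E0 vec2E1 /hex_ineq !ler_norml.
    by split; apply/andP; split; lra.
  rewrite map_mxM scalerA scalemxAl vec2Z; congr (_ *m _).
  by apply: rV2P; rewrite ?vec2E0 ?vec2E1 !mxE /=; field; lra.
- move=> m w m0 w0 [_ [_ [h /hexagonP hh <-] <-] wE].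
  have wV : map_mx intr (w *m invmx W) = (m * l) *: h.
    by rewrite map_mxM -wE UW scalerA -scalemxAl -mulmxA WV mulmx1.
  rewrite leNgt; apply/negP; rewrite ltr_pdivlMr; last lra.
  move=> ml; have ml2 : 3 * (m * l) < 2 by lra.
  have /negP[] : w *m invmx W != 0 by rewrite rV2_mulmx_neq0 ?unitmx_inv.
  have h0 : ((w *m invmx W) 0 0)%:~R = m * l * h 0 0.
    by have /rowP/(_ 0) := wV; rewrite !mxE.
  have h1 : ((w *m invmx W) 0 1)%:~R = m * l * h 0 1.
    by have /rowP/(_ 1) := wV; rewrite !mxE.
  have [|z0 z1] :=
    @hex_ineq_int _ _ ((w *m invmx W) 0 0) ((w *m invmx W) 0 1) ml2.
    have ml0 : 0 <= m * l by rewrite mulr_ge0 // ltW.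
    by rewrite h0 h1; exact: hex_ineqZ.
  by apply/eqP; apply: rV2P; rewrite [RHS]mxE.
Qed.

(** The functional x has maximum 2 on the hexagon. A nonzero integer functional with a smaller
    maximum is excluded by its values at the vertices. *)
Lemma lambda1_polar_hexagon {R : realType} (l : R) (U : 'M[int]_2) :
  0 < l -> U \in unitmx ->
  lambda1 (polar_set (scale_set l (int_mx_image U hexagon))) = 2 * l.
Proof.
move=> l0 Uu; have [UV VU] := @intmx_inv R _ _ Uu.
have polarE y : polar_set (scale_set l (int_mx_image U hexagon)) y <->
    forall h, hexagon h -> l * inner h (y *m map_mx intr U) <= 1.
  split=> [yP h hh|yP _ [_ [h hh <-] <-]]; last first.
    by rewrite innerZl inner_mulmx trmxK yP.
  have := yP (l *: (h *m (map_mx intr U)^T)).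
  rewrite innerZl inner_mulmx trmxK; apply; exists (h *m (map_mx intr U)^T) => //.
  by exists h.
pose e : 'rV[int]_2 := \row_j (if j == 0 then 1 else 0).
have e0 : e != 0 by rewrite rV2_neq0 !mxE.
apply: (@lambda1_eq _ _ _ _ (e *m invmx U)).
- apply/polarE => h _; rewrite mul0mx inner2E !mxE !mulr0 addr0 mulr0; lra.
- lra.
- by rewrite rV2_mulmx_neq0 ?unitmx_inv.
- exists ((2 * l)^-1 *: map_mx intr (e *m invmx U)); last first.
    by rewrite scalerA mulfV ?scale1r //; lra.
  apply/polarE => h /hexagonP; rewrite -scalemxAl innerZr map_mxM.
  rewrite -mulmxA VU mulmx1 inner2E !mxE /= mulr0 mulr1 addr0.
  rewrite /hex_ineq !ler_norml => -[/andP[? ?] _ /andP[? ?]].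
  have -> : l * ((2 * l)^-1 * h 0 0) = h 0 0 / 2 by field; lra.
  lra.
- move=> m w m0 w0 [y /polarE yP yE].
  rewrite leNgt; apply/negP => ml.
  have /negP[] : w *m U != 0 by rewrite rV2_mulmx_neq0.
  have wU : map_mx intr (w *m U) = m *: (y *m map_mx intr U).
    by rewrite map_mxM -yE scalemxAl.
  have le1 h : hexagon h -> inner h (map_mx intr (w *m U)) <= m / l.
    move=> /yP; rewrite wU innerZr => le1; rewrite ler_pdivlMr //.
    by rewrite -mulrA [_ * l]mulrC -[leRHS]mulr1 ler_wpM2l.
  have c2 : m / l < 2 by rewrite ltr_pdivrMr.
  have V v1 v2 : hex_ineq 3 v1 v2 ->
      v1 * ((w *m U) 0 0)%:~R + v2 * ((w *m U) 0 1)%:~R <= m / l.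
    move=> hv; have := le1 (vec2 v1 v2).
    rewrite inner2E vec2E0 vec2E1 !mxE; apply.
    by apply/hexagonP; rewrite vec2E0 vec2E1.
  have V' v1 v2 : `|v1 + v2| <= 3 -> `|2 * v2 - v1| <= 3 ->
      `|2 * v1 - v2| <= 3 ->
      v1 * ((w *m U) 0 0)%:~R + v2 * ((w *m U) 0 1)%:~R <= m / l.
    by move=> *; exact: V.
  (* At the vertices (p, q) takes the values 2p + q, p + 2q, q - p and their negatives, which up to
     sign are the three forms of [hex_ineq] at (p, -q). *)
  have [|z0 /eqP] :=
      @hex_ineq_int _ _ ((w *m U) 0 0) (- (w *m U) 0 1) c2.
    rewrite intrN.
    have := V' 2 1; have := V' (-2) (-1); have := V' 1 2; have := V' (-1) (-2).
    have := V' 1 (-1); have := V' (-1) 1; rewrite !ler_norml.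
    do 6 (move=> /(_ ltac:(lra) ltac:(lra) ltac:(lra)) ?).
    by split; rewrite ler_norml; apply/andP; split; lra.
  rewrite oppr_eq0 => /eqP z1.
  by apply/eqP; apply: rV2P; rewrite [RHS]mxE.
Qed.

(** * From an extremal body to the hexagon *)

(** If the maximum M of the functional on K were below mu, then z would lie in m K* for m halfway
    between max(M, 0) and mu; the 0 keeps m positive. *)
Lemma polar_width_ge {R : realType} {d : nat} (K : set 'rV[R]_d) (mu : R)
    (z : 'rV[int]_d) :
  K !=set0 -> compact K -> 0 < mu ->
  (forall m : R, 0 <= m -> scale_set m (polar_set K) (map_mx intr z) ->
     mu <= m) ->
  exists2 x, K x & mu <= inner x (map_mx intr z).
Proof.
move=> Kn0 cK mu0 lb.
have [|x /set_mem Kx xmax] :=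
  @EVT_max_rV R d (fun x => inner x (map_mx intr z)) K Kn0 cK.
  by apply: continuous_subspaceT; exact: inner_continuous.
exists x => //; set M := inner _ _ in xmax *.
rewrite leNgt; apply/negP => Mmu; pose m := (Num.max M 0 + mu) / 2.
have M0 : M <= Num.max M 0 by rewrite le_max lexx.
have M1 : 0 <= Num.max M 0 by rewrite le_max lexx orbT.
have M2 : Num.max M 0 < mu by rewrite gt_max Mmu.
have m0 : 0 < m by rewrite /m; lra.
have : mu <= m.
  apply: lb; first exact: ltW.
  exists (m^-1 *: map_mx intr z); last by rewrite scalerA mulfV ?scale1r ?gt_eqF.
  move=> y /mem_set /xmax yM; rewrite innerZr mulrC ler_pdivrMr // mul1r.
  by apply: le_trans yM _; rewrite /m; lra.
rewrite /m; lra.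
Qed.

(** Bezout coefficients give a second row that makes the determinant 1; the inverse is the
    adjugate. *)
Lemma primitive_row (z : 'rV[int]_2) : gcdz (z 0 0) (z 0 1) = 1 ->
  exists2 W : 'M[int]_2, W \in unitmx & row 0 W = z.
Proof.
have [u [v <-]] := Bezoutz (z 0 0) (z 0 1) => uv.
exists (mx2 (z 0 0) (z 0 1) (- v) u).
  have [] // := @mulmx1_unit _ _ (mx2 (z 0 0) (z 0 1) (- v) u)
    (mx2 u (- z 0 1) v (z 0 0)).
  by rewrite mulmx_mx2 -mx2_1; congr mx2; lia.
by apply: rV2P; rewrite !mxE.
Qed.

(** The planar result is applied to the dilate of K by its first minimum, in a lattice basis
    starting with a shortest vector. It puts this dilate inside the hexagon with k = 2 and the
    vertices of that hexagon inside the dilate. *)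
Lemma extremal_hexagon {R : realType} (K : set 'rV[R]_2) :
  convex_body K -> origin_symmetric K ->
  4 / 3 <= lambda1 K * lambda1 (polar_set K) ->
  exists2 l : R, 0 < l &
     exists2 U : 'M[int]_2, U \in unitmx &
       K = scale_set l (int_mx_image U hexagon).
Proof.
move=> [Kn0 cK /convex_setP cvK] symK le43.
have symK' x : K x -> K (- x) by move=> Kx; rewrite -symK; exists x.
have K0 : K 0.
  case: Kn0 => x Kx; have := cvK (1 / 2) x (- x).
  have -> : 1 - 1 / 2 = 1 / 2 :> R by lra.
  by rewrite scalerN subrr; apply; [lra|lra| |exact: symK'].
have pK0 : polar_set K 0.
  by move=> x _; rewrite inner2E !mxE !mulr0 addr0.
have la0 : lambda1 K != 0 by apply/eqP => la; move: le43; rewrite la mul0r; lra.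
have mu0 : lambda1 (polar_set K) != 0.
  by apply/eqP => mu; move: le43; rewrite mu mulr0; lra.
have [] := lambda1_neq0 _ pK0 mu0; have [] := lambda1_neq0 _ K0 la0.
move: (lambda1 K) (lambda1 (polar_set K)) le43 => la mu le43.
move=> {}la0 [z z0 [x Kx xz]] lamin {}mu0 _ mumin.
have lan0 : la != 0 by rewrite gt_eqF.
have lat (c : R) (w : 'rV[int]_2) : w != 0 ->
    K (la^-1 *: (c *: map_mx intr w)) -> c <= 1.
  move=> w0 Kw; rewrite leNgt; apply/negP => c1.
  have : la <= la / c.
    apply: (lamin _ w) => //; first by rewrite divr_ge0 ?ltW //; lra.
    exists (la^-1 *: (c *: map_mx intr w)) => //.
    rewrite !scalerA; have -> : la / c * la^-1 * c = 1 by field; lra.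
    by rewrite scale1r.
  rewrite ler_pdivlMr; last lra.
  by rewrite leNgt -[ltLHS]mulr1 ltr_pM2l ?c1.
(* If z = g w, then w is reached already at la / g, so g <= 1 by minimality. *)
have gz : gcdz (z 0 0) (z 0 1) = 1.
  set g := gcdz _ _.
  pose w : 'rV[int]_2 := \row_j divz (z 0 j) g.
  have zw : z = g *: w.
    by apply: rV2P; rewrite !mxE mulrC divzK // ?dvdz_gcdl ?dvdz_gcdr.
  have w0 : w != 0 by apply: contra z0 => /eqP w0; rewrite zw w0 scaler0.
  have g0 : 0 < g.
    rewrite lt_def; apply/andP; split=> //; apply: contra z0 => /eqP g0.
    by rewrite zw g0 scale0r.
  have : g%:~R <= 1 :> R.
    apply: (lat _ w) => //.
    have -> : g%:~R *: map_mx intr w = map_mx intr z :> 'rV[R]_2.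
      by rewrite [in RHS]zw; apply/rowP => j; rewrite !mxE intrM.
    by rewrite -xz scalerA mulVf // scale1r.
  rewrite -[1](mulr1z 1) ler_int; lia.
have [W Wu Wz] := primitive_row _ gz.
have [WV VW] := @intmx_inv R _ _ Wu.
pose Q a b := K (la^-1 *: (vec2 a b *m map_mx intr W)).
have [k [Phex P1 P2 P3]] : exists k : int, let P a b := Q (a + k%:~R * b) b in
  [/\ forall a b, P a b -> hex_ineq 2 a b,
      P (4 / 3) (2 / 3), P (2 / 3) (4 / 3) & P (2 / 3) (- (2 / 3))].
  apply: planar_extremal.
  - move=> t a b c d t0 t1 Qab Qcd; have := cvK _ _ _ t0 t1 Qab Qcd.
    rewrite /Q; congr K; rewrite -vec2D -!vec2Z mulmxDl -!scalemxAl scalerDr.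
    by rewrite !scalerA ![la^-1 * _]mulrC.
  - by move=> a b /symK'; rewrite /Q -scalerN -mulNmx vec2N.
  - rewrite /Q; have -> : vec2 1 0 *m map_mx intr W = map_mx intr z :> 'rV[R]_2.
      rewrite -Wz map_row; have -> : vec2 1 0 = delta_mx 0 0 :> 'rV[R]_2.
        by apply: rV2P; rewrite !mxE.
      by rewrite -rowE.
    by rewrite -xz scalerA mulVf // scale1r.
  - move=> m n c mn Qc; pose w : 'rV[int]_2 := \row_j (if j == 0 then m else n).
    apply: (lat c (w *m W)).
      by rewrite rV2_mulmx_neq0 // rV2_neq0 !mxE.
    move: Qc; rewrite /Q -vec2Z -scalemxAl map_mxM intr_rV2E.
    by rewrite !mxE.
  (* The functional w in the coordinates of W is the integer functional y on K, whose maximum is at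
     least mu; scaling by la gives la mu >= 4/3. *)
  - move=> m n mn; pose w : 'rV[int]_2 := \row_j (if j == 0 then m else n).
    pose y := w *m (invmx W)^T.
    have y0 : y != 0.
      by rewrite rV2_mulmx_neq0 ?unitmx_tr ?unitmx_inv // rV2_neq0 !mxE.
    have [u Ku uy] := @polar_width_ge _ _ K mu y Kn0 cK mu0
      (fun m m0 => mumin m y m0 y0).
    have uE : u = la^-1 *: (la *: (u *m map_mx intr (invmx W)) *m map_mx intr W).
      by rewrite -scalemxAl -mulmxA VW mulmx1 scalerA mulVf // scale1r.
    set v := la *: (u *m map_mx intr (invmx W)) in uE.
    exists (v 0 0), (v 0 1); split; first by rewrite /Q -vec2_eta -uE.
    have -> : m%:~R * v 0 0 + n%:~R * v 0 1 = inner v (map_mx intr w).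
      by rewrite inner2E !mxE /= mulrC [n%:~R * _]mulrC.
    rewrite /v innerZl inner_mulmx map_trmx -map_mxM.
    apply: le_trans le43 _; by rewrite ler_wpM2l // ltW.
(* The shear of the planar result is absorbed into the lattice basis. *)
pose S : 'M[int]_2 := mx2 1 0 k 1.
have SW : S *m W \in unitmx.
  rewrite unitmx_mul Wu andbT.
  have [] // := @mulmx1_unit _ _ S (mx2 1 0 (- k) 1).
  by rewrite mulmx_mx2 -mx2_1; congr mx2; lia.
have PE a b : Q (a + k%:~R * b) b =
    K (la^-1 *: (vec2 a b *m map_mx intr (S *m W))).
  rewrite /Q map_mxM mulmxA vec2_mulmx; congr (K (_ *: (vec2 _ _ *m _))); ring.
have [TV VT] := @intmx_inv R _ _ SW.
move: PE TV VT; set T := S *m W in SW * => PE TV VT.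
rewrite PE in P1; rewrite PE in P2; rewrite PE in P3.
(* The factor 2/3 passes from k = 3 to k = 2, and 1 / la undoes the dilation. *)
exists (2 / (3 * la)); first by rewrite divr_gt0 //; lra.
exists T^T; first by rewrite unitmx_tr.
rewrite /int_mx_image map_trmx trmxK.
apply/seteqP; split=> y.
  move=> Ky; pose v := la *: (y *m map_mx intr (invmx T)).
  have yE : y = la^-1 *: (v *m map_mx intr T).
    by rewrite -scalemxAl -mulmxA VT mulmx1 scalerA mulVf // scale1r.
  exists ((3 / 2) *: v *m map_mx intr T).
    exists ((3 / 2) *: v) => //; apply/hexagonP.
    have /Phex : Q (v 0 0 + k%:~R * v 0 1) (v 0 1).
      by rewrite PE -vec2_eta -yE.
    rewrite !mxE /hex_ineq !ler_norml.
    by move=> [/andP[? ?] /andP[? ?] /andP[? ?]]; split; apply/andP; split; lra.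
  rewrite -scalemxAl scalerA [RHS]yE; congr (_ *: _); field; lra.
move=> [_ [h hh <-] <-].
apply: (hh [set v | K (2 / (3 * la) *: (v *m map_mx intr T))]); split.
  apply/convex_setP => t v w t0 t1 Kv Kw; have := cvK _ _ _ t0 t1 Kv Kw.
  rewrite /=; congr K; rewrite mulmxDl -!scalemxAl scalerDr.
  by rewrite !scalerA ![2 / (3 * la) * _]mulrC.
have sc a b : K (la^-1 *: (vec2 (2 / 3 * a) (2 / 3 * b) *m map_mx intr T)) ->
    K (2 / (3 * la) *: (vec2 a b *m map_mx intr T)).
  rewrite -vec2Z -scalemxAl scalerA; congr (K (_ *: _)); field; lra.
have {P1} P1 : K (2 / (3 * la) *: (vec2 2 1 *m map_mx intr T)).
  by apply: sc; move: P1; congr (K (_ *: (vec2 _ _ *m _))); lra.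
have {P2} P2 : K (2 / (3 * la) *: (vec2 1 2 *m map_mx intr T)).
  by apply: sc; move: P2; congr (K (_ *: (vec2 _ _ *m _))); lra.
have {P3} P3 : K (2 / (3 * la) *: (- vec2 (-1) 1 *m map_mx intr T)).
  by rewrite vec2N; apply: sc; move: P3; congr (K (_ *: (vec2 _ _ *m _))); lra.
move=> v /=; rewrite !inE => /or4P[|||/or3P[]] /eqP -> //.
- by move/symK': P1; rewrite -scalerN -mulNmx.
- by move/symK': P2; rewrite -scalerN -mulNmx.
- by move/symK': P3; rewrite -scalerN -mulNmx opprK.
Qed.

Theorem theorem1p4 (R : realType) (K : set 'rV[R]_2)
  (bodyK : convex_body K) (symK : origin_symmetric K) (K0 : K° 0) :
  lambda1 K * lambda1 (polar_set K) <= 4 / 3 /\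
  (lambda1 K * lambda1 (polar_set K) = 4 / 3 <->
   exists2 l : R, 0 < l &
     exists2 U : 'M[int]_2, U \in unitmx &
       K = scale_set l (int_mx_image U hexagon)).
Proof.
have hexE : (exists2 l : R, 0 < l &
     exists2 U : 'M[int]_2, U \in unitmx &
       K = scale_set l (int_mx_image U hexagon)) ->
    lambda1 K * lambda1 (polar_set K) = 4 / 3.
  move=> [l l0 [U Uu ->]].
  by rewrite lambda1_hexagon // lambda1_polar_hexagon //; field; lra.
split; last by split=> // E; apply: extremal_hexagon; rewrite // E.
(* A product above 4/3 would also make K such a hexagon, whose product is exactly 4/3. *)
rewrite leNgt; apply/negP => lt43.
have E := hexE (extremal_hexagon _ bodyK symK (ltW lt43)).
by rewrite E ltxx in lt43.
Qed.
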